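(* Let $c_0,c_1,c_2,c_3\in\mathbb{R}$ with $c_3c_1=(c_2)^2$, and let $$F(p_1,p_2,p_3)=c_3\sigma_3(p)+c_2\sigma_2(p)+c_1\sigma_1(p)+c_0.$$ Consider the ODE system $$\frac{p_i''}{2}\,F(p_1,p_2,p_3)=(p_i')^2\,\frac{\partial F}{\partial p_i}(p_1,p_2,p_3),\qquad i=1,2,3,$$ for real-valued $C^2$ functions $p_i(s)$ on an interval, with $p_i'\neq0$ and $F(p_1,p_2,p_3)\ne0$ along the solution, and put $R_i=1/p_i'$. The system admits the following first integrals. (i) If $c_3\neq0$, let $a=c_2/c_3$. Then $(p_1+a)R_1-(p_j+a)R_j$, $j=2,3$, are first integrals. (ii) If $c_3=0$, then $R_1-R_j$, $j=2,3$, are first integrals.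
   Context: $\sigma_k(p)$ is the $k$-th elementary symmetric polynomial of $p_1,p_2,p_3$; primes denote $d/ds$. A first integral is a function of $(p_i,p_i')$ that is constant along every solution. *)

(* Defs.v *)
From HB Require Import structures.
From mathcomp Require Import all_boot all_order all_algebra.
From mathcomp Require Import all_classical all_reals all_analysis.
From mathcomp Require mpoly.

Set Implicit Arguments.
Unset Strict Implicit.
Unset Printing Implicit Defensive.

Import Order.TTheory GRing.Theory Num.Theory.
Import numFieldNormedType.Exports.

Local Open Scope classical_set_scope.
Local Open Scope ring_scope.

(* The triple (p_1, p_2, p_3) is a row vector; its entries have the indices
   0, 1, 2 of 'I_3. *)
Definition sigma (R : realType) (k : nat) (p : 'rV[R]_3) : R :=
  mpoly.meval (p ord0) (mpoly.mesym 3 R k).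

Definition symF (R : realType) (c0 c1 c2 c3 : R) (p : 'rV[R]_3) : R :=
  c3 * sigma 3 p + c2 * sigma 2 p + c1 * sigma 1 p + c0.

Definition partial (R : realType) (F : 'rV[R]_3 -> R) (i : 'I_3)
    (p : 'rV[R]_3) : R :=
  'D_(delta_mx ord0 i) F p.

(* l is the derivative at x of f restricted to D: it is one-sided when D is an
   interval and x one of its end points. *)
Definition is_derive_within (R : realType) (D : set R) (f : R -> R) (x l : R)
    : Prop :=
  (f y - f x) / (y - x) @[y --> within (D `\ x) (nbhs x)] --> l.

(* f is C^2 on D, with first derivative f1 and second derivative f2. *)
Definition C2_within (R : realType) (D : set R) (f f1 f2 : R -> R) : Prop :=
  [/\ forall x, D x -> is_derive_within D f x (f1 x),
      forall x, D x -> is_derive_within D f1 x (f2 x)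
    & {within D, continuous f2}].

(* p1 and p2 stand for p' and p''.  The interval J may be open, closed or
   half-open, bounded or not.  On a one-point J the derivatives are not
   determined, but there constancy along a solution says nothing. *)
Definition is_solution (R : realType) (F : 'rV[R]_3 -> R) (J : set R)
    (p p1 p2 : R -> 'rV[R]_3) : Prop :=
  [/\ is_interval J,
      forall i : 'I_3, C2_within J (fun s => p s ord0 i)
        (fun s => p1 s ord0 i) (fun s => p2 s ord0 i),
      forall s, J s -> F (p s) != 0,
      forall s (i : 'I_3), J s -> p1 s ord0 i != 0
    & forall s (i : 'I_3), J s ->
        p2 s ord0 i / 2 * F (p s) = (p1 s ord0 i) ^+ 2 * partial F i (p s)].

Definition first_integral (R : realType) (F : 'rV[R]_3 -> R)
    (Phi : 'rV[R]_3 -> 'rV[R]_3 -> R) : Prop :=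
  forall (J : set R) (p p1 p2 : R -> 'rV[R]_3), is_solution F J p p1 p2 ->
  exists k : R, forall s, J s -> Phi (p s) (p1 s) = k.

(* Main.v *)
(* If c3 <> 0, the condition c3 c1 = c2^2 makes F = c3 (p_1 + a)(p_2 + a)(p_3 + a) + const;
   if c3 = 0, it forces c2 = 0 and F = c1 (p_1 + p_2 + p_3) + c0.  So with weight
   w_i = p_i + a, respectively w_i = 1, the product w_i dF/dp_i does not depend on i.
   Since R_i' = - p_i'' / p_i'^2 = - 2 (dF/dp_i) / F, neither does (w_i R_i)', which is
   w_i' / p_i' - 2 (w_i dF/dp_i) / F, where w_i' / p_i' is the constant 1 or 0. *)
Require Import Defs.
From mathcomp Require Import all_boot all_order all_algebra.
From mathcomp Require Import all_classical all_reals all_analysis.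
From mathcomp Require mpoly.
From mathcomp Require Import ring.
Import (canonicals) mpoly.

Import Order.TTheory GRing.Theory Num.Theory.
Import numFieldNormedType.Exports.
Local Open Scope classical_set_scope.
Local Open Scope ring_scope.

Lemma sigmaE (R : realType) (k : nat) (p : 'rV[R]_3) :
  sigma k p = \sum_(h : {set 'I_3} | #|h| == k) \prod_(i in h) p ord0 i.
Proof.
rewrite /sigma /mpoly.mesym raddf_sum; apply: eq_bigr => h _ /=.
by rewrite rmorph_prod; apply: eq_bigr => i _; rewrite /= mpoly.mevalXU.
Qed.

Lemma sigma1E (R : realType) (p : 'rV[R]_3) : sigma 1 p = \sum_i p ord0 i.
Proof.
rewrite /sigma mpoly.mesym1E raddf_sum.
by apply: eq_bigr => i _; rewrite /= mpoly.mevalXU.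
Qed.

(** Vieta: expanding the product chooses the set [h] of factors that contribute [p_i], the others
    contributing [b]; the sets of size [k] add up to [b ^+ (3 - k) * sigma k p]. *)
Lemma prod_addE (R : realType) (b : R) (p : 'rV[R]_3) :
  \prod_i (p ord0 i + b) = b ^+ 3 + b ^+ 2 * sigma 1 p + b * sigma 2 p + sigma 3 p.
Proof.
transitivity (\sum_(k < 4) b ^+ (3 - k) * sigma k p).
  (* A subset of ['I_3] has at most 3 elements, so [inord] into ['I_4] keeps its cardinality. *)
  rewrite bigA_distr (partition_big (fun h : {set 'I_3} => inord #|h| : 'I_4) predT) //=.
  apply: eq_bigr => k _; rewrite sigmaE mulr_sumr.
  have card_inord (h : {set 'I_3}) : (inord #|h| == k) = (#|h| == k).
    by rewrite -val_eqE/= inordK// ltnS -[leqRHS](card_ord 3) max_card.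
  apply: eq_big => [h|h]; rewrite card_inord// => /eqP <-.
  rewrite (bigID (mem h))/= mulrC; congr (_ * _); last first.
    by apply: eq_bigr => i ->.
  under eq_bigr => i /negPf-> do [].
  by rewrite prodr_const; congr (_ ^+ _); exact: canRL (addKn _) (etrans (cardC h) (card_ord 3)).
rewrite !big_ord_recr big_ord0/= /sigma mpoly.mesym0E mpoly.meval1.
ring.
Qed.

(** Along the [i]-th axis the difference quotient equals [l] for every [h != 0]. This applies to
    [symF], which is affine in each variable. *)
Lemma partial_affine {R : realType} {F : 'rV[R]_3 -> R} {i : 'I_3} {p : 'rV[R]_3} (l : R) :
  (forall h, F (h *: delta_mx ord0 i + p) = F p + h * l) -> partial F i p = l.
Proof.
move=> Fl; apply/cvg_lim => //.
apply: cvg_near_cst; near=> h => /=.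
rewrite Fl addrAC subrr add0r /GRing.scale/= mulrA mulVf ?mul1r//.
by near: h; exact: nbhs_dnbhs_neq.
Unshelve. all: by end_near. Qed.

Lemma prod_add_delta (R : realType) (b h : R) (i : 'I_3) (p : 'rV[R]_3) :
  \prod_k ((h *: delta_mx ord0 i + p) ord0 k + b) =
  \prod_k (p ord0 k + b) + h * \prod_(k | k != i) (p ord0 k + b).
Proof.
rewrite (bigD1 i)//= [in RHS](bigD1 i)//= !mxE !eqxx mulr1.
under eq_bigr => k /negPf ki do rewrite !mxE ki andbF mulr0 add0r.
ring.
Qed.

Lemma cvg_is_derive_within {R : realType} {D : set R} {f : R -> R} {x l : R} :
  is_derive_within D f x l -> f y @[y --> within D (nbhs x)] --> f x.
Proof.
move=> fl.
have : (f y - f x) / (y - x) * (y - x) @[y --> within (D `\ x) (nbhs x)] --> l * (x - x).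
  by apply: cvgM => //; apply: cvg_within_filter; apply: cvgB; [exact: cvg_id|exact: cvg_cst].
rewrite subrr mulr0 => /cvgrPdist_lt f0; apply/cvgrPdist_lt => e e0.
have := f0 _ e0; rewrite !near_withinE; apply: filterS => y /= Hy Dy.
(* The limit over [D] without [x] says nothing at [y = x], where the difference vanishes anyway. *)
have [->|yx] := eqVneq y x; first by rewrite subrr normr0.
have := Hy (conj Dy (fun e => negP yx (introT eqP e))).
by rewrite divfK ?subr_eq0// sub0r normrN distrC.
Qed.

(** Near an interior point the restriction to [D] is void, so the slope function, given the value
    [l] at [x], is continuous there: Caratheodory's criterion. *)
Lemma is_derive_interior {R : realType} {D : set R} {f : R -> R} {x l : R} :
  D° x -> is_derive_within D f x l -> is_derive x 1 f l.
Proof.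
move=> Dx fl; apply/is_derive1_caratheodory.
exists (fun y => if y == x then l else (f y - f x) / (y - x)); split; last by rewrite eqxx.
  move=> y; case: eqVneq => [->|yx]; first by rewrite !subrr mulr0.
  by rewrite divfK// subr_eq0.
apply/continuous_withinNx; rewrite eqxx.
have : (f y - f x) / (y - x) @[y --> x^'] --> l.
  apply: cvg_trans fl; apply: cvg_fmap2 => A; rewrite /within/= /dnbhs /within/= => HA.
  move: Dx HA; rewrite /interior; apply: filterS2 => y Dy + yx; apply; split=> //; exact/eqP.
apply: cvg_trans; apply: near_eq_cvg; near=> y.
rewrite ifN//; near: y; exact: nbhs_dnbhs_neq.
Unshelve. all: by end_near. Qed.

(** Mean value theorem on [[u, v]]. End points of [J] enter only through continuity, so two-sided
    derivatives in the interior suffice. *)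
Lemma eq_of_is_derive0_within {R : realType} {J : set R} (f : R -> R) {u v : R} :
  is_interval J -> (forall x, J x -> f y @[y --> within J (nbhs x)] --> f x) ->
  (forall x, J° x -> is_derive x 1 f 0) -> J u -> J v -> f u = f v.
Proof.
move=> Jitv fc f0 Ju Jv.
wlog uv : u v Ju Jv / u < v.
  by move=> H; have [/H->//|/H->//|->] := ltgtP u v.
have sJ : `[u, v] `<=` J.
  by move=> z; rewrite /= in_itv/= => /(Jitv _ _ Ju Jv).
have dJ x : x \in `]u, v[ -> is_derive x 1 f (cst 0 x).
  move=> xuv; apply: f0; rewrite /interior; apply: filterS (near_in_itvoo xuv) => z zuv.
  by apply: sJ; apply: subset_itv_oo_cc.
have cf : {within `[u, v], continuous f}.
  apply/subspace_continuousP => x xuv.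
  by apply: cvg_trans (fc x (sJ _ xuv)); apply: cvg_fmap2; apply: within_subset.
have [c _] := MVT uv dJ cf.
by rewrite mul0r => /eqP; rewrite subr_eq0 => /eqP.
Qed.

(** One weight [b * p_i + a] serves both cases: [b = 1] when [c3 != 0], and [b = 0], [a = 1] when
    [c3 = 0]. *)
Lemma weighted_first_integral {R : realType} {F : 'rV[R]_3 -> R} (b a : R) (i j : 'I_3) :
  (forall p : 'rV[R]_3, (b * p ord0 i + a) * partial F i p = (b * p ord0 j + a) * partial F j p) ->
  first_integral F (fun p p' : 'rV[R]_3 => (b * p ord0 i + a) * (1 / p' ord0 i)
                              - (b * p ord0 j + a) * (1 / p' ord0 j)).
Proof.
move=> eqF J p p1 p2 [Jitv C2 F0 p10 ode].
have [->|/set0P[s0 Js0]] := eqVneq J set0; first by exists 0.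
pose G k s := (b * p s ord0 k + a) * (p1 s ord0 k)^-1.
have G_cvg k s : J s -> G k y @[y --> within J (nbhs s)] --> G k s.
  move=> Js; have [/(_ s Js) dp /(_ s Js) dp1 _] := C2 k.
  apply: cvgM; last apply: cvgV.
  - apply: cvgD (cvg_cst _); apply: cvgM (cvg_cst _) _; exact: cvg_is_derive_within dp.
  - exact: p10.
  - exact: cvg_is_derive_within dp1.
(* The left side has the shape that the product rule gives for [G k]: [P] is the weight, [P1] and
   [P2] are the derivatives of [p_k], [A] is the partial derivative and [f] the value of [F]. *)
have rate (P P1 P2 A f : R) : f != 0 -> P1 != 0 -> P2 / 2 * f = P1 ^+ 2 * A ->
    P * (- P1 ^- 2 * P2) + P1^-1 * (b * P1) = b - 2 * (P * A) / f.
  move=> fN0 P1N0 P2E.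
  have -> : P2 = 2 * (P1 ^+ 2 * A) / f by rewrite -P2E; field.
  by field; rewrite fN0.
have G_derive k s : J° s ->
    is_derive s 1 (G k) (b - 2 * ((b * p s ord0 k + a) * partial F k (p s)) / F (p s)).
  move=> Js; have Js' := interior_subset Js.
  have [/(_ s Js') dp /(_ s Js') dp1 _] := C2 k.
  have Dp := is_derive_interior Js dp.
  have DR := is_deriveV (p10 s k Js') (is_derive_interior Js dp1).
  have DG : is_derive s 1 (G k) _ := is_deriveM (is_deriveD (is_deriveZ b Dp) (is_derive_cst a s 1)) DR.
  by apply: is_derive_eq; rewrite addr0; apply: rate => //; [exact: F0|exact: p10|exact: ode].
exists (G i s0 - G j s0) => s Js; rewrite !div1r.
apply: (eq_of_is_derive0_within (G i - G j) Jitv) => // x Jx.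
  exact: cvgB (G_cvg i x Jx) (G_cvg j x Jx).
have := is_deriveB (G_derive i x Jx) (G_derive j x Jx).
by rewrite eqF subrr.
Qed.

Theorem proposition5p6 (R : realType) (c0 c1 c2 c3 : R)
  (hc : c3 * c1 = c2 ^+ 2) :
  (c3 != 0 ->
     let a := c2 / c3 in
     forall j : 'I_3, j != ord0 ->
     first_integral (symF c0 c1 c2 c3)
       (fun p p' => (p ord0 ord0 + a) * (1 / p' ord0 ord0)
                    - (p ord0 j + a) * (1 / p' ord0 j))) /\
  (c3 = 0 ->
     forall j : 'I_3, j != ord0 ->
     first_integral (symF c0 c1 c2 c3)
       (fun _ p' => 1 / p' ord0 ord0 - 1 / p' ord0 j)).
Proof.
split=> [c3N0 a j _|c30 j _].
(* The subtracted [c3 * a ^+ 3] is the constant term of the expanded product; [hc] makes the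
   coefficient of [sigma 1] match. *)
- have FE (p : 'rV[R]_3) : symF c0 c1 c2 c3 p = c3 * \prod_k (p ord0 k + a) + (c0 - c3 * a ^+ 3).
    have -> : c1 = c3 * a ^+ 2 by rewrite -(mulKf c3N0 c1) hc /a; field.
    have -> : c2 = c3 * a by rewrite /a; field.
    by rewrite /symF prod_addE; ring.
  have dF i (p : 'rV[R]_3) : (1 * p ord0 i + a) * partial (symF c0 c1 c2 c3) i p =
                c3 * \prod_k (p ord0 k + a).
    (* The slope is the product without its [i]-th factor; the weight restores that factor, which
       leaves a value independent of [i]. *)
    rewrite (partial_affine (c3 * \prod_(k | k != i) (p ord0 k + a))).
      by rewrite [in RHS](bigD1 i)//=; ring.
    by move=> h; rewrite !FE prod_add_delta; ring.
  have := weighted_first_integral 1 a ord0 j (fun p => etrans (dF _ p) (esym (dF _ p))).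
  by move=> H J p p1 p2 /H[k Hk]; exists k => s /Hk; rewrite !mul1r.
- have c20 : c2 = 0 by apply/eqP; rewrite -sqrf_eq0 -hc c30 mul0r.
  have dF i (p : 'rV[R]_3) : (0 * p ord0 i + 1) * partial (symF c0 c1 c2 c3) i p = c1.
    rewrite (partial_affine c1); first by ring.
    move=> h; rewrite /symF c30 c20 !sigma1E.
    rewrite (bigD1 i)//= [in RHS](bigD1 i)//= !mxE !eqxx/=.
    under eq_bigr => k /negPf ki do rewrite !mxE ki andbF mulr0 add0r.
    ring.
  have := weighted_first_integral 0 1 ord0 j (fun p => etrans (dF _ p) (esym (dF _ p))).
  by move=> H J p p1 p2 /H[k Hk]; exists k => s /Hk; rewrite !mul0r !add0r !mul1r.
Qed.
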